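(* Let $\{E_i\}_{i=1}^{d^2}$ and $\{\rho_m\}_{m=1}^{d^2}$ both be the natural basis $\{|j\rangle\langle k|\}_{1\le j,k\le d}$ of $\mathbb C_{d\times d}$. Then the two-step optimization (TSO) Hamiltonian identification method (excluding the time spent on experiments) has computational complexity $O(d^6)$, where $d$ is the dimension of the Hamiltonian.
   Context: Complexity counts arithmetic operations on complex numbers. It is taken as known that the spectral decomposition of an $n\times n$ Hermitian matrix, the polar decomposition of an $n\times n$ matrix, and the Schur decomposition of an $n\times n$ matrix each cost $O(n^3)$, and that state reconstruction by linear regression estimation (LRE) from measured frequencies for $d$-dimensional states costs $O(d^6)$ offline (once) and $O(d^4)$ online per reconstructed state. $\text{vec}(\cdot)$ is column-stacking vectorization and $\text{vec}^{-1}$ maps a vector of length $n^2$ back to an $n\times n$ matrix. The natural basis is ordered by $E_i=\rho_i=|j\rangle\langle k|$ with $i=(j-1)d+k$, where $|1\rangle,\dots,|d\rangle$ is the standard basis of $\mathbb C^d$. Numbers $\beta_{mn}^{jk}$ are defined by $E_j\rho_mE_k^\dagger=\sum_n\beta_{mn}^{jk}\rho_n$, and $B$ is the $d^4\times d^4$ matrix with rows indexed by $(m,n)$ ($m$ varying fastest), columns indexed by $(j,k)$ ($j$ varying fastest), and entries $\beta_{mn}^{jk}$. The unknown $d\times d$ Hermitian $H$ has known smallest eigenvalue $h_1$, and $\mathcal E(\rho)=e^{-iHt}\rho e^{iHt}$ with $t$ known. The TSO method: 1. Determine $B$. Reconstruct, by LRE, the output states under $\mathcal E$ of the $O(d^2)$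 probe states $|j\rangle\langle j|$, $|+\rangle\langle+|$, $|-\rangle\langle-|$ with $|+\rangle=(|j\rangle+|k\rangle)/\sqrt2$, $|-\rangle=(|j\rangle+i|k\rangle)/\sqrt2$, $j\neq k$. For $j\ne k$ set $\hat{\mathcal E}(|j\rangle\langle k|)=\hat{\mathcal E}(|+\rangle\langle+|)+i\hat{\mathcal E}(|-\rangle\langle-|)-\frac{1+i}{2}\hat{\mathcal E}(|j\rangle\langle j|)-\frac{1+i}{2}\hat{\mathcal E}(|k\rangle\langle k|)$. 2. Determine $\hat\Lambda=[\hat\lambda_{mn}]$ from $\hat{\mathcal E}(\rho_m)=\sum_n\hat\lambda_{mn}\rho_n$. 3. Compute $\hat D=\text{vec}^{-1}(B^\dagger\text{vec}(\hat\Lambda))$, a $d^2\times d^2$ matrix. 4. Compute $\hat S=\sqrt{\hat\alpha_1/2}\,\hat P_1$, where $\hat\alpha_1$ is the largest eigenvalue of $\hat D+\hat D^\dagger$ and $\text{vec}(\hat P_1)$ a corresponding unit eigenvector, $\hat P_1\in\mathbb C_{d\times d}$. 5. Compute $\hat G=\hat S(\hat S^\dagger\hat S)^{-1/2}$ by polar decomposition. 6. Compute by Schur decomposition $\hat G^T=\hat Q\exp(i\,\text{diag}(\hat\theta_j))\hat Q^\dagger$ with $\hat Q$ unitary and $0\le\hat\theta_1\le\dots\le\hat\theta_d<2\pi$. If $\hat\theta_d-\hat\theta_1\ge\pi$, let $k$ be the smallest index with $\hat\theta_k-\hat\theta_1\ge\pi$ and replace $\hat\theta_j$ by $\hat\theta_j-2\pi$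 for $j\ge k$. Put $\hat\theta_0=\max_j\hat\theta_j$, $\bar\theta_j=\hat\theta_j-h_1t-\hat\theta_0$, and output $\hat H=-\hat Q\,\text{diag}(\bar\theta_j)\,\hat Q^\dagger/t$. *)

(* Defs.v *)
From HB Require Import structures.
From mathcomp Require Import all_boot all_order all_algebra.
From mathcomp Require Import spectral sesquilinear.
From mathcomp Require Import complex.
From mathcomp Require Import all_classical all_reals all_analysis.

Set Implicit Arguments.
Unset Strict Implicit.
Unset Printing Implicit Defensive.

Import Order.TTheory GRing.Theory Num.Theory.
Import numFieldNormedType.Exports.

Local Open Scope classical_set_scope.
Local Open Scope ring_scope.
Local Open Scope sesquilinear_scope.

Definition isO (R : realType) (f g : nat -> nat) : Prop :=
  (fun n => (f n)%:R : R^o) =O_\oo (fun n => (g n)%:R : R^o).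

(** * Machine model

  Algebraic computation trees over the complex numbers.  A program never sees
  a scalar: it manipulates addresses of memory cells, so scalar information
  can only be obtained through costed operations.  Addressing and data
  movement are free, and the only constants available are 0, 1, i and pi.
  Besides field operations and conjugation, the square root (needed for the
  factor [sqrt (alpha_1 / 2)]), the argument (needed to read the phases off the
  unit eigenvalues of a Schur form) and comparisons of real parts cost 1. *)

Inductive op : Type :=
| Zero | One | ImagUnit | Pi
| Add | Sub | Mul | Div
| Conj | Sqrt | Arg
| SpectralDec of nat | PolarDec of nat | SchurDec of nat
| LREOffline of nat | LREOnline of nat.

(** [nf d] is the number of measured frequencies per reconstructed state, and
  [ns d] the number of scalars produced by the offline stage of LRE. *)
Definition in_size (nf ns : nat -> nat) (o : op) : nat :=
  match o with
  | Zero | One | ImagUnit | Pi => 0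
  | Add | Sub | Mul | Div => 2
  | Conj | Sqrt | Arg => 1
  | SpectralDec n | PolarDec n | SchurDec n => n * n
  | LREOffline d => 0
  | LREOnline d => ns d + nf d
  end.

Definition out_size (ns : nat -> nat) (o : op) : nat :=
  match o with
  | SpectralDec n => n * n + n
  | PolarDec n | SchurDec n => n * n + n * n
  | LREOffline d => ns d
  | LREOnline d => d * d
  | _ => 1
  end.

Definition addr := nat.

Inductive prog (nf ns : nat -> nat) (A : Type) : Type :=
| Ret of A
| Do (o : op) of 'rV[addr]_(in_size nf ns o)
    & ('rV[addr]_(out_size ns o) -> prog nf ns A)
| TestLe of addr & addr & (bool -> prog nf ns A).

Record costs := Costs {
  spectral_cost : nat -> nat;
  polar_cost : nat -> nat;
  schur_cost : nat -> nat;
  lre_offline_cost : nat -> nat;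
  lre_online_cost : nat -> nat }.

Definition op_cost (w : costs) (o : op) : nat :=
  match o with
  | SpectralDec n => spectral_cost w n
  | PolarDec n => polar_cost w n
  | SchurDec n => schur_cost w n
  | LREOffline d => lre_offline_cost w d
  | LREOnline d => lre_online_cost w d
  | _ => 1
  end.

(** * Matrix notions *)

Section Matrices.
Variable R : realType.
Notation C := R[i].

Definition expi (x : R) : C := Complex (cos x) (sin x).

(** The argument of [z != 0] in [0, 2 pi[. *)
Definition carg (z : C) : R :=
  let a := acos (complex.Re z / Num.sqrt (complex.Re z ^+ 2 + complex.Im z ^+ 2))
  in if 0 <= complex.Im z then a else 2 * pi - a.

Definition psdmx n (A : 'M[C]_n) : Prop :=
  A \is hermsymmx /\ forall v : 'cV[C]_n, 0 <= (v^t* *m A *m v) 0 0.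

Definition is_spectral n (A U : 'M[C]_n) (l : 'rV[C]_n) : Prop :=
  [/\ U \is unitarymx, l \is a realmx & A = U *m diag_mx l *m U^t*].

Definition is_polar n (A G P : 'M[C]_n) : Prop :=
  [/\ G \is unitarymx, psdmx P & A = G *m P].

(** [is_trig_mx] means lower triangular. *)
Definition is_schur n (A Q T : 'M[C]_n) : Prop :=
  [/\ Q \is unitarymx, is_trig_mx T^T & A = Q *m T *m Q^t*].

(** [mxvec] is row-major and yields a row, hence the transpositions: the
  entry [A m n] sits at position [mxvec_index n m] of [vec A]. *)
Definition vec n (A : 'M[C]_n) : 'cV[C]_(n * n) := (mxvec A^T)^T.
Definition unvec n (v : 'cV[C]_(n * n)) : 'M[C]_n := (vec_mx v^T)^T.

Definition smallest_eigenvalue n (A : 'M[C]_n) (a : C) : Prop :=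
  eigenvalue A a /\ forall b, eigenvalue A b -> a <= b.

Definition largest_eigenvalue n (A : 'M[C]_n) (a : C) : Prop :=
  eigenvalue A a /\ forall b, eigenvalue A b -> b <= a.

End Matrices.

(** * Execution of programs *)

(** Arbitrary procedures solving the decomposition problems (unspecified
  outside the stated domains), and an arbitrary two-stage procedure for state
  reconstruction. *)
Record oracles (R : realType) (nf ns : nat -> nat) := Oracles {
  spectral_dec : forall n, 'M[R[i]]_n -> 'M[R[i]]_n * 'rV[R[i]]_n;
  polar_dec : forall n, 'M[R[i]]_n -> 'M[R[i]]_n * 'M[R[i]]_n;
  schur_dec : forall n, 'M[R[i]]_n -> 'M[R[i]]_n * 'M[R[i]]_n;
  lre_offline : forall d, 'rV[R[i]]_(ns d);
  lre_online : forall d, 'rV[R[i]]_(ns d) -> 'rV[R[i]]_(nf d) -> 'M[R[i]]_d;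
  spectral_decP : forall n (A : 'M[R[i]]_n), A \is hermsymmx ->
    is_spectral A (spectral_dec A).1 (spectral_dec A).2;
  polar_decP : forall n (A : 'M[R[i]]_n),
    is_polar A (polar_dec A).1 (polar_dec A).2;
  schur_decP : forall n (A : 'M[R[i]]_n),
    is_schur A (schur_dec A).1 (schur_dec A).2 }.

Section Execution.
Variables (R : realType) (nf ns : nat -> nat) (O : oracles R nf ns) (w : costs).
Notation C := R[i].

Definition run_op (o : op) : 'rV[C]_(in_size nf ns o) -> 'rV[C]_(out_size ns o) :=
  match o return 'rV[C]_(in_size nf ns o) -> 'rV[C]_(out_size ns o) with
  | Zero => fun _ => const_mx 0
  | One => fun _ => const_mx 1
  | ImagUnit => fun _ => const_mx 'i
  | Pi => fun _ => const_mx (real_complex R pi)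
  | Add => fun x : 'rV_2 => const_mx (x 0 ord0 + x 0 ord_max)
  | Sub => fun x : 'rV_2 => const_mx (x 0 ord0 - x 0 ord_max)
  | Mul => fun x : 'rV_2 => const_mx (x 0 ord0 * x 0 ord_max)
  | Div => fun x : 'rV_2 => const_mx (x 0 ord0 / x 0 ord_max)
  | Conj => fun x : 'rV_1 => const_mx (x 0 0)^*
  | Sqrt => fun x : 'rV_1 => const_mx (sqrtC (x 0 0))
  | Arg => fun x : 'rV_1 => const_mx (real_complex R (carg (x 0 0)))
  | SpectralDec n => fun x =>
      let: (U, l) := spectral_dec O (vec_mx x) in row_mx (mxvec U) l
  | PolarDec n => fun x =>
      let: (G, P) := polar_dec O (vec_mx x) in row_mx (mxvec G) (mxvec P)
  | SchurDec n => fun x =>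
      let: (Q, T) := schur_dec O (vec_mx x) in row_mx (mxvec Q) (mxvec T)
  | LREOffline d => fun _ => lre_offline O d
  | LREOnline d => fun x => mxvec (lre_online O (lsubmx x) (rsubmx x))
  end.

Definition memory := seq C.

Definition load (m : memory) p q (a : 'M[addr]_(p, q)) : 'M[C]_(p, q) :=
  map_mx (nth 0 m) a.

(** Results are appended to the memory, so no cell is ever overwritten. *)
Definition store (m : memory) n (v : 'rV[C]_n) : memory :=
  m ++ [seq v 0 i | i <- enum 'I_n].

Definition new_cells (m : memory) n : 'rV[addr]_n := \row_i (size m + i)%N.

(** Returned value, final memory and total cost. *)
Fixpoint exec (A : Type) (p : prog nf ns A) (m : memory) : A * memory * nat :=
  match p with
  | Ret a => (a, m, 0%N)
  | Do o args k =>
      let: (a, m', c) := exec (k (new_cells m (out_size ns o)))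
                              (store m (run_op (load m args))) in
      (a, m', (op_cost w o + c)%N)
  | TestLe x y k =>
      let: (a, m', c) :=
        exec (k (complex.Re (nth 0 m x) <= complex.Re (nth 0 m y))) m in
      (a, m', c.+1)
  end.

End Execution.

(** * The TSO method *)

Definition distinct_pair (d : nat) := {jk : 'I_d * 'I_d | jk.1 != jk.2}.

(** The indices of [|j><j|], of [|+><+|] and of [|-><-|]. *)
Definition probe (d : nat) := ('I_d + distinct_pair d + distinct_pair d)%type.

Section TSO.
Variables (R : realType) (d : nat).
Notation C := R[i].
Notation N := (d * d)%N.

Definition ket (j : 'I_d) : 'cV[C]_d := delta_mx j 0.
Definition proj (v : 'cV[C]_d) : 'M[C]_d := v *m v^t*.
Definition ket_plus (j k : 'I_d) : 'cV[C]_d := (sqrtC 2)^-1 *: (ket j + ket k).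
Definition ket_minus (j k : 'I_d) : 'cV[C]_d :=
  (sqrtC 2)^-1 *: (ket j + 'i *: ket k).

Definition probe_state (p : probe d) : 'M[C]_d :=
  match p with
  | inl (inl j) => proj (ket j)
  | inl (inr jk) => proj (ket_plus (val jk).1 (val jk).2)
  | inr jk => proj (ket_minus (val jk).1 (val jk).2)
  end.

(** [natural_basis (mxvec_index j k) = delta_mx j k = |j><k|], where
  [mxvec_index j k] has value [j * d + k] (all indices start at 0). *)
Definition natural_basis (i : 'I_N) : 'M[C]_d := vec_mx (delta_mx 0 i).

(** The input of the machine: [h1], [t] and the measured frequencies, where
  [freq rho] are those of the output state for the probe state [rho]. *)
Definition input_index (nf : nat -> nat) := (bool + probe d * 'I_(nf d))%type.

Definition input_value nf (h1 t : R) (freq : 'M[C]_d -> 'rV[R]_(nf d))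
    (x : input_index nf) : C :=
  match x with
  | inl b => real_complex R (if b then t else h1)
  | inr (p, i) => real_complex R (freq (probe_state p) 0 i)
  end.

Definition init_mem nf h1 t (freq : 'M[C]_d -> 'rV[R]_(nf d)) : memory R :=
  [seq input_value h1 t freq x | x <- enum {: input_index nf}].

Record tso_result (V : Type) := TSOResult {
  res_B : 'M[V]_(N * N);
  res_Lambda : 'M[V]_N;
  res_D : 'M[V]_N;
  res_S : 'M[V]_d;
  res_G : 'M[V]_d;
  res_H : 'M[V]_d }.

Definition load_result (m : memory R) (r : tso_result addr) : tso_result C :=
  TSOResult (load m (res_B r)) (load m (res_Lambda r)) (load m (res_D r))
            (load m (res_S r)) (load m (res_G r)) (load m (res_H r)).

Definition is_B (B : 'M[C]_(N * N)) : Prop :=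
  exists beta : 'I_N -> 'I_N -> 'I_N -> 'I_N -> C,
    (forall j k m, natural_basis j *m natural_basis m *m (natural_basis k)^t*
       = \sum_n beta m n j k *: natural_basis n) /\
    (forall m n j k, B (mxvec_index n m) (mxvec_index k j) = beta m n j k).

Section Reconstruction.
Variables (nf ns : nat -> nat) (O : oracles R nf ns).
Variable freq : 'M[C]_d -> 'rV[R]_(nf d).

Definition reconstruct (rho : 'M[C]_d) : 'M[C]_d :=
  lre_online O (lre_offline O d) (map_mx (real_complex R) (freq rho)).

(** The estimated image of [|j><k|]. *)
Definition Ehat (j k : 'I_d) : 'M[C]_d :=
  if j == k then reconstruct (proj (ket j)) else
  reconstruct (proj (ket_plus j k)) + 'i *: reconstruct (proj (ket_minus j k))
  - ((1 + 'i) / 2) *: reconstruct (proj (ket j))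
  - ((1 + 'i) / 2) *: reconstruct (proj (ket k)).

Definition is_Lambda (Lambda : 'M[C]_N) : Prop :=
  forall j k : 'I_d,
    Ehat j k = \sum_n Lambda (mxvec_index j k) n *: natural_basis n.

End Reconstruction.

Definition is_S (D : 'M[C]_N) (S : 'M[C]_d) : Prop :=
  exists (alpha1 : C) (P1 : 'M[C]_d),
    [/\ largest_eigenvalue (D + D^t*) alpha1,
        (D + D^t*) *m vec P1 = alpha1 *: vec P1,
        (vec P1)^t* *m vec P1 = 1%:M
      & S = sqrtC (alpha1 / 2) *: P1].

(** [K] is [(S^dagger S)^(1/2)].  The formula [S *m invmx K] only makes sense
  for invertible [S]; otherwise any unitary polar factor is accepted. *)
Definition is_G (S G : 'M[C]_d) : Prop :=
  exists K : 'M[C]_d,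
    [/\ psdmx K, K *m K = S^t* *m S, is_polar S G K
      & S \in unitmx -> G = S *m invmx K].

(** With zero-based indices, [find] returns the least [k] such that
  [theta_k - theta_0 >= pi]. *)
Definition rebranch (theta : d.-tuple R) (j : 'I_d) : R :=
  let k := find (fun x => pi <= x - head 0 theta) theta in
  if (pi <= last 0 theta - head 0 theta) && (k <= j)%N
  then tnth theta j - 2 * pi else tnth theta j.

Definition is_H (h1 t : R) (G H : 'M[C]_d) : Prop :=
  exists (Q : 'M[C]_d) (theta : d.-tuple R) (theta0 : R),
    [/\ Q \is unitarymx,
        G^T = Q *m diag_mx (\row_j expi (tnth theta j)) *m Q^t*,
        sorted <=%R theta /\ all (fun x => (0 <= x) && (x < 2 * pi)) theta,
        (exists j, theta0 = rebranch theta j) /\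
          (forall j, rebranch theta j <= theta0)
      & H = - (real_complex R t)^-1 *:
              (Q *m diag_mx (\row_j real_complex R
                               (rebranch theta j - h1 * t - theta0))
                 *m Q^t*)].

Definition tso_run nf ns (O : oracles R nf ns)
    (freq : 'M[C]_d -> 'rV[R]_(nf d)) (h1 t : R) (r : tso_result C) : Prop :=
  [/\ is_B (res_B r),
      is_Lambda O freq (res_Lambda r),
      res_D r = unvec ((res_B r)^t* *m vec (res_Lambda r)),
      is_S (res_D r) (res_S r)
    & is_G (res_S r) (res_G r) /\ is_H h1 t (res_G r) (res_H r)].

End TSO.

(** The program computes a TSO run on every input, in time at most [T]. *)
Definition implements_tso (R : realType) (nf ns : nat -> nat) (w : costs)
    (P : forall d, prog nf ns (tso_result d addr)) (T : nat -> nat) : Prop :=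
  forall (d : nat) (O : oracles R nf ns)
         (Htrue : 'M[R[i]]_d) (h1 t : R) (freq : 'M[R[i]]_d -> 'rV[R]_(nf d)),
    (0 < d)%N ->
    Htrue \is hermsymmx -> smallest_eigenvalue Htrue (real_complex R h1) ->
    t != 0 ->
    let: (r, m, c) := exec O w (P d) (init_mem h1 t freq) in
    tso_run O freq h1 t (load_result m r) /\ (c <= T d)%N.

(* Main.v *)
(** Conjugating by the natural basis gives
  [|a><b| |c><g| (|e><f|)^dagger = delta_bc delta_gf |a><e|], so [B] is a
  permutation matrix and [vec^-1 (B^dagger vec Lambda)] only rearranges the
  entries of [Lambda]: no arithmetic is spent on either.  The offline stage of
  LRE, the [O(d^2)] online reconstructions at cost [O(d^4)] each and the spectral
  decomposition of the [d^2 x d^2] matrix [D + D^dagger] contribute [O(d^6)]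
  each; the remaining steps, including a comparison of all pairs of
  eigenvalues or phases, cost [O(d^4)].  Since memory cells are never
  overwritten, every fact about a stored value persists, and correctness and
  cost are tracked together by triples [runs] with a cost bound. *)
Require Import Defs.
From mathcomp Require Import all_boot all_order all_algebra.
From mathcomp Require Import all_classical all_reals all_analysis.
From mathcomp Require Import spectral sesquilinear complex.
From mathcomp Require Import lra zify.

Set Implicit Arguments.
Unset Strict Implicit.
Unset Printing Implicit Defensive.

Import Order.TTheory GRing.Theory Num.Theory.

Local Open Scope ring_scope.
Local Open Scope sesquilinear_scope.

(** * Correctness of the six steps *)

(** Inverse of [mxvec_index], given explicitly so that rearrangements of matrices can be written as
    functions of addresses. *)
Definition unpair d (i : 'I_(d * d)) : 'I_d * 'I_d :=
  enum_val (cast_ord (esym (mxvec_cast d d)) i).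

Lemma mxvec_indexK d (a b : 'I_d) : unpair (mxvec_index a b) = (a, b).
Proof. by rewrite /unpair /mxvec_index cast_ordK enum_rankK. Qed.

Lemma mxvec_index_inj d (a b a' b' : 'I_d) :
  mxvec_index a b = mxvec_index a' b' -> a = a' /\ b = b'.
Proof. by move=> /(congr1 (@unpair d)); rewrite !mxvec_indexK => -[]. Qed.

Section Math.
Variable R : realType.
Notation C := R[i].

Lemma unvecE n (v : 'cV[C]_(n * n)) i j : unvec v i j = v (mxvec_index j i) 0.
Proof. by rewrite !mxE. Qed.

Lemma unvecK n (v : 'cV[C]_(n * n)) : vec (unvec v) = v.
Proof. by rewrite /vec /unvec trmxK vec_mxK trmxK. Qed.

Lemma natural_basis_delta d (a b : 'I_d) :
  natural_basis R (mxvec_index a b) = delta_mx a b.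
Proof. exact: vec_mx_delta. Qed.

Lemma sum_natural_basis d (v : 'rV[C]_(d * d)) :
  \sum_n v 0 n *: natural_basis R n = vec_mx v.
Proof.
rewrite [in RHS](row_sum_delta v) linear_sum; apply: eq_bigr => n _.
by rewrite linearZ.
Qed.

End Math.

(** * The transfer matrix [B] in the natural basis *)

Section TransferMatrix.
Variables (V : Type) (d : nat).
Notation N := (d * d)%N.

(** The row [(m, n)] with [rho_m = |c><g|] and [rho_n = |a><e|] has its only
  nonzero entry in the column [(j, k)] with [E_j = |a><c|] and [E_k = |e><g|]. *)
Definition matrix_B (zero one : V) : 'M[V]_(N * N) :=
  \matrix_(r, c)
    let: (n, m) := unpair r in let: (k, j) := unpair c in
    if (unpair j == ((unpair n).1, (unpair m).1)) &&
       (unpair k == ((unpair n).2, (unpair m).2)) then one else zero.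

(** By the pattern of [B], the entry of [D] at [(|a><c|, |e><f|)] is that of [Lambda] at
    [(|c><f|, |a><e|)]. The type [V] is arbitrary so that one rearrangement acts both on addresses
    and on values. *)
Definition matrix_D (L : 'M[V]_N) : 'M[V]_N :=
  \matrix_(j, k) L (mxvec_index (unpair j).2 (unpair k).2)
                   (mxvec_index (unpair j).1 (unpair k).1).

End TransferMatrix.

Section TransferSpec.
Variables (R : realType) (d : nat).
Notation C := R[i].
Notation N := (d * d)%N.
Notation B := (@matrix_B C d 0 1).

Lemma matrix_BE (a b c f g e : 'I_d) (m := mxvec_index c f)
    (n := mxvec_index a e) (k : 'I_N) (j := mxvec_index g b) :
  B (mxvec_index n m) (mxvec_index k j) =
  ((g == a) && (b == c) && (k == mxvec_index e f))%:R.
Proof.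
rewrite mxE !mxvec_indexK /=; case/mxvec_indexP: k => k1 k2.
rewrite mxvec_indexK !xpair_eqE.
have -> : (mxvec_index k1 k2 == mxvec_index e f) = (k1 == e) && (k2 == f).
  by apply/eqP/andP => [/mxvec_index_inj[-> ->]|[/eqP-> /eqP->]].
by case: (_ && _ && _).
Qed.

Lemma is_B_matrix_B : is_B B.
Proof.
exists (fun m n j k => B (mxvec_index n m) (mxvec_index k j)); split=> // j k m.
case/mxvec_indexP: j => a b; case/mxvec_indexP: k => e f.
case/mxvec_indexP: m => c g; rewrite !natural_basis_delta.
(* Only [n = |a><e|] can contribute to the product [|a><b| |c><g| |f><e|]. *)
rewrite (bigD1 (mxvec_index a e)) //= [X in _ + X]big1 ?addr0; last first.
  case/mxvec_indexP=> a' e' ne.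
  rewrite matrix_BE; case: eqP => [aa|]; last by rewrite scale0r.
  case: eqP => [_|]; last by rewrite scale0r.
  case: eqP => [/mxvec_index_inj[ee _]|]; last by rewrite scale0r.
  by rewrite aa ee eqxx in ne.
rewrite matrix_BE natural_basis_delta eqxx /= trmx_delta map_delta_mx.
rewrite mul_delta_mx_cond.
have -> : (mxvec_index e f == mxvec_index e g) = (g == f).
  by apply/eqP/eqP => [/mxvec_index_inj[]|->].
case: (b == c) => /=; last by rewrite mulr0n mul0mx scale0r.
by rewrite mulr1n mul_delta_mx_cond scaler_nat.
Qed.

Lemma matrix_DP (L : 'M[C]_N) : unvec (B^t* *m vec L) = matrix_D L.
Proof.
apply/matrixP => j k; rewrite unvecE mxE.
case/mxvec_indexP: j => a c; case/mxvec_indexP: k => e f.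
(* With [j = |a><c|] and [k = |e><f|], the column [(j, k)] of [B] is nonzero only in the row with
   [n = |a><e|] and [m = |c><f|]. *)
rewrite (bigD1 (mxvec_index (mxvec_index a e) (mxvec_index c f))) //=.
rewrite !mxE big1 ?addr0; last first.
  case/mxvec_indexP; case/mxvec_indexP => a' e'; case/mxvec_indexP => c' f' ne.
  rewrite [X in X * _]mxE [X in X^* * _]mxE matrix_BE.
  case: eqP => [aa|]; last by rewrite conjC0 mul0r.
  case: eqP => [cc|]; last by rewrite conjC0 mul0r.
  case: eqP => [/mxvec_index_inj[ee ff]|]; last by rewrite conjC0 mul0r.
  by rewrite aa ee ff cc eqxx in ne.
rewrite mxvecE !mxE !(mxvec_indexK a c, mxvec_indexK e f) /=.
rewrite (mxvec_indexK (mxvec_index a e)) (mxvec_indexK (mxvec_index e f)).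
by rewrite !mxvec_indexK !eqxx /= conjC1 mul1r.
Qed.

Lemma is_LambdaP nf ns (O : oracles R nf ns) freq (L : 'M[C]_N) :
  (forall j k a b, L (mxvec_index j k) (mxvec_index a b) = Ehat O freq j k a b) ->
  is_Lambda O freq L.
Proof.
move=> LE j k.
rewrite (eq_bigr (fun n => row (mxvec_index j k) L 0 n *: natural_basis R n)).
  by rewrite sum_natural_basis; apply/matrixP => a b; rewrite !mxE LE.
by move=> n _; rewrite mxE.
Qed.

End TransferSpec.

(** * Spectral, polar and Schur decompositions *)

Section Decompositions.
Variable R : realType.
Notation C := R[i].

Lemma hermsymmxE n (A : 'M[C]_n) : (A \is hermsymmx) = (A == A^t*).
Proof. by rewrite qualifE /= expr0 scale1r. Qed.

Lemma add_adjoint_hermitian n (A : 'M[C]_n) : A + A^t* \is hermsymmx.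
Proof.
rewrite hermsymmxE; apply/eqP; rewrite [in RHS]linearD map_mxD /=.
by rewrite trmxCK addrC.
Qed.

(** The order on [C] demands equal imaginary parts, while the machine compares real parts only; on
    real numbers the two agree. *)
Lemma real_leE (x y : C) : x \is Num.real -> y \is Num.real ->
  (x <= y) = (complex.Re x <= complex.Re y).
Proof.
by move=> /complex_realP[a ->] /complex_realP[b ->]; rewrite lecE /= eqxx.
Qed.

Lemma is_spectral_eigen n (A U : 'M[C]_n) l i : is_spectral A U l ->
  A *m col i U = l 0 i *: col i U.
Proof.
case=> /unitarymxP Uu _ ->.
have Uu' : U^t* *m U = 1%:M by apply: mulmx1C.
rewrite colE -!mulmxA (mulmxA _ U) Uu' mul1mx.
rewrite scalemxAr; congr (_ *m _); apply/colP => j; rewrite !mxE.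
rewrite (bigD1 i) //= big1 ?addr0; last first.
  by move=> k /negPf ki; rewrite !mxE ki mulr0.
by rewrite !mxE eqxx mulr1; case: eqP => [->|]; rewrite ?mulr1// mulr0.
Qed.

(** Multiplication by [U] turns row eigenvectors of [A] into row eigenvectors of the diagonal
    matrix, so every eigenvalue is an entry of [l]. *)
Lemma is_spectral_largest n (A U : 'M[C]_n) l i : is_spectral A U l ->
  (forall j, complex.Re (l 0 j) <= complex.Re (l 0 i)) ->
  largest_eigenvalue A (l 0 i).
Proof.
case=> Uu lreal AE lmax.
have U1 : U *m U^t* = 1%:M by apply/unitarymxP.
have U2 : U^t* *m U = 1%:M by apply: mulmx1C.
have UA : U^t* *m A = diag_mx l *m U^t* by rewrite AE !mulmxA U2 mul1mx.
split=> [|b].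
  (* [eigenvalue] is about row vectors; row [i] of [U^dagger] is nonzero because
     [U^dagger U = 1]. *)
  apply/eigenvalueP; exists (row i (U^t*)).
    by rewrite -row_mul UA row_mul row_diag_mx -scalemxAl -rowE.
  apply/eqP => r0; move: U2 => /(congr1 (row i)).
  rewrite row_mul r0 mul0mx => /rowP /(_ i).
  by rewrite !mxE eqxx => /esym/eqP; rewrite oner_eq0.
move=> /eigenvalueP[v vA v0].
pose u := v *m U.
have uD : u *m diag_mx l = b *: u.
  by rewrite /u scalemxAl -vA AE -!mulmxA U2 mulmx1.
have : u != 0.
  by apply: contraNneq v0 => u0; rewrite -[v]mulmx1 -U1 mulmxA -/u u0 mul0mx.
case/rV0Pn => j uj.
have <- : l 0 j = b.
  apply: (mulfI uj); move/rowP: uD => /(_ j).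
  by rewrite mul_mx_diag mxE [in RHS]mxE [in RHS]mulrC.
by rewrite real_leE ?(mxOverP lreal).
Qed.

Lemma is_S_of_spectral d (D U : 'M[C]_(d * d)) l i :
  is_spectral (D + D^t*) U l ->
  (forall j, complex.Re (l 0 j) <= complex.Re (l 0 i)) ->
  is_S D (sqrtC (l 0 i / 2) *: unvec (col i U)).
Proof.
move=> spec lmax; exists (l 0 i), (unvec (col i U)).
rewrite unvecK; split=> //; first exact: is_spectral_largest spec lmax.
  exact: is_spectral_eigen spec.
case: spec => /unitarymxP/mulmx1C U2 _ _; apply/matrixP => a b.
move/matrixP: U2 => /(_ i i); rewrite !ord1 !mxE !eqxx => <-.
by apply: eq_bigr => k _; rewrite !mxE.
Qed.

(** As [G] is unitary and [P] Hermitian, [S^dagger S = P G^dagger G P = P^2], so [P] serves as [K];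
    it is invertible whenever [S] is. *)
Lemma is_G_of_polar d (S G P : 'M[C]_d) : is_polar S G P -> is_G S G.
Proof.
move=> pol; case: (pol) => Gu Ppsd SE.
exists P; split=> //.
  case: (Ppsd) => + _; rewrite hermsymmxE => /eqP Ph.
  have G2 : G^t* *m G = 1%:M by apply: mulmx1C; apply/unitarymxP.
  by rewrite SE trmx_mul map_mxM -Ph -mulmxA (mulmxA _ G) G2 mul1mx.
move=> Su; have Pu : P \in unitmx.
  by move: Su; rewrite SE unitmx_mul => /andP[].
by rewrite SE mulmxK.
Qed.

(** By induction on the row: once the earlier rows are diagonal, column [i] has
  [T i i] as its only nonzero entry, which then exhausts the norm of row [i]. *)
Lemma unitary_trig_diag n (T : 'M[C]_n) :
  T \is unitarymx -> is_trig_mx T^T -> is_diag_mx T.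
Proof.
move=> /unitarymxP T1 /is_trig_mxP Tu.
have T2 := mulmx1C T1.
apply/is_diag_mxP => i.
have [k] := ubnP (val i); elim: k i => // k IHk i; rewrite ltnS => ik j ij.
have IH (i' j' : 'I_n) : (i' < i)%N -> i' != j' -> T i' j' = 0.
  by move=> ii'; apply: IHk; exact: leq_trans ii' ik.
have [ji|ji] := leqP j i.
  by have := Tu j i; rewrite mxE; apply; rewrite ltn_neqAle eq_sym ij.
have Tii : `|T i i| ^+ 2 = 1.
  move/matrixP: T2 => /(_ i i); rewrite !mxE eqxx (bigD1 i) //= big1 ?addr0.
    by rewrite !mxE mulrC -normCK.
  move=> l ki; rewrite !mxE; have [lki|lki] := ltnP l i.
    by rewrite (IH l i) ?mulr0.
  have -> : T l i = 0.
    by have := Tu i l; rewrite mxE; apply; rewrite ltn_neqAle lki andbT eq_sym.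
  by rewrite mulr0.
have /matrixP/(_ i i) := T1; rewrite !mxE eqxx (bigD1 i) //= !mxE -normCK Tii.
move=> /(canRL (addKr _)); rewrite addNr => /psumr_eq0P H.
have := H _ j (_ : j != i); rewrite !mxE -normCK => H0.
apply/eqP; rewrite -normr_eq0 -sqrf_eq0; apply/eqP; apply: H0.
  by move=> l _; rewrite !mxE -normCK exprn_ge0.
by apply: contraNneq ij => ->.
Qed.

End Decompositions.

(** * Phases of complex numbers of modulus one *)

Section Phases.
Variable R : realType.
Notation C := R[i].

Lemma norm1_sqr (z : C) : `|z| = 1 ->
  complex.Re z ^+ 2 + complex.Im z ^+ 2 = 1.
Proof.
rewrite normc_def => -[] /(congr1 (fun x => x ^+ 2)).
by rewrite sqr_sqrtr ?addr_ge0 ?sqr_ge0// expr1n.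
Qed.

Lemma norm1_Re (z : C) : `|z| = 1 -> -1 <= complex.Re z <= 1.
Proof.
move=> /norm1_sqr h; rewrite -ler_norml -(@ler_pXn2r _ 2) ?nnegrE //.
by rewrite expr1n real_normK ?num_real // -h lerDl sqr_ge0.
Qed.

Lemma norm1_carg (z : C) : `|z| = 1 ->
  carg z = if 0 <= complex.Im z then acos (complex.Re z)
           else 2 * pi - acos (complex.Re z).
Proof. by move=> /norm1_sqr h; rewrite /carg h sqrtr1 divr1. Qed.

Lemma carg_bounds (z : C) : `|z| = 1 -> 0 <= carg z < 2 * pi.
Proof.
move=> z1; rewrite norm1_carg //; have Re1 := norm1_Re z1.
have := acos_ge0 Re1; have := acos_lepi Re1; have := @pi_gt0 R.
case: (lerP 0 (complex.Im z)) => [_|Im0] p0 a0 a1; first by lra.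
(* Excludes the value [2 pi]: a vanishing [acos] forces real part 1, which leaves no room for a
   negative imaginary part. *)
have : acos (complex.Re z) != 0.
  apply/eqP => /(congr1 (@cos R)); rewrite acosK ?in_itv //= cos0 => Rez.
  by move: (norm1_sqr z1); rewrite Rez; clear -Im0 => ?; nra.
by rewrite neq_lt => /orP[]; lra.
Qed.

(** The cosine of the [acos] gives back the real part and its sine the modulus of the imaginary
    part; passing to [2 pi - acos] restores a negative sign. *)
Lemma cargK (z : C) : `|z| = 1 -> expi (carg z) = z.
Proof.
move=> z1; rewrite norm1_carg //; have Re1 := norm1_Re z1.
have sinE : sin (acos (complex.Re z)) = `|complex.Im z|.
  by rewrite sin_acos // -(norm1_sqr z1) addrC addKr sqrtr_sqr.
have cosE : cos (acos (complex.Re z)) = complex.Re z.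
  by rewrite acosK ?in_itv.
rewrite /expi; case: leP => Im0.
  by rewrite sinE cosE ger0_norm //; case: (z).
have -> : 2 * pi - acos (complex.Re z) = - acos (complex.Re z) + pi *+ 2.
  by rewrite addrC mulr_natl.
rewrite cosD2pi sinD2pi cosN sinN sinE cosE ltr0_norm // opprK.
by case: (z).
Qed.

End Phases.

(** * From a Schur form of [G^T] to the Hamiltonian *)

Section HamiltonianStep.
Variables (R : realType) (d : nat).
Notation C := R[i].

Lemma unitary_diag_norm n (T : 'M[C]_n) i :
  T \is unitarymx -> is_diag_mx T -> `|T i i| = 1.
Proof.
move=> /unitarymxP T1 /is_diag_mxP Td; apply/eqP.
rewrite -(@pexpr_eq1 _ _ 2) //; apply/eqP; rewrite normCK.
have /matrixP/(_ i i) := T1; rewrite !mxE eqxx (bigD1 i) //= big1 ?addr0.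
  by rewrite !mxE.
by move=> j ji; rewrite Td ?mul0r // eq_sym.
Qed.

Lemma schur_unitary (A Q T : 'M[C]_d) :
  A \is unitarymx -> is_schur A Q T -> T \is unitarymx.
Proof.
move=> Au [Qu _ AE].
have Q2 : Q^t* *m Q = 1%:M by apply: mulmx1C; apply/unitarymxP.
have -> : T = Q^t* *m A *m Q by rewrite AE !mulmxA Q2 mul1mx -mulmxA Q2 mulmx1.
by rewrite !mul_unitarymx // trmxC_unitary.
Qed.

(** [T] is unitary and triangular, hence diagonal with unit entries, whose arguments are the phases
    of [G^T]. Sorting them by [s] permutes the columns of [Q] accordingly. The conclusion is
    entrywise because these sums are what the program evaluates. *)
Lemma is_H_of_schur h1 t (G Q T : 'M[C]_d) (s : 'I_d -> 'I_d) (i0 jmax : 'I_d)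
    (theta := fun j => carg (T (s j) (s j)))
    (reb := fun j => if pi <= theta j - theta i0 then theta j - 2 * pi
                     else theta j) :
  G \is unitarymx -> is_schur G^T Q T -> injective s -> i0 = 0%N :> nat ->
  (forall i j : 'I_d, (i <= j)%N -> theta i <= theta j) ->
  (forall j, reb j <= reb jmax) ->
  is_H h1 t G (\matrix_(a, b) (- (real_complex R t)^-1 *
    \sum_k Q a (s k) * real_complex R (reb k - h1 * t - reb jmax)
            * (Q b (s k))^*)).
Proof.
move=> Gu sch sinj i00 thetale jmaxP.
have GTu : G^T \is unitarymx by rewrite trmx_unitary.
have Tu := schur_unitary GTu sch.
have [Qu Ttrig GTE] := sch.
have Td := unitary_trig_diag Tu Ttrig.
have T1 i := unitary_diag_norm i Tu Td.
pose Q' := \matrix_(a, k) Q a (s k) : 'M[C]_d.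
have conjE (f : 'I_d -> C) : Q' *m diag_mx (\row_j f j) *m Q'^t* =
    \matrix_(a, b) \sum_k Q a (s k) * f k * (Q b (s k))^*.
  apply/matrixP => a b; rewrite mul_mx_diag !mxE; apply: eq_bigr => k _.
  by rewrite !mxE.
pose th := [tuple theta j | j < d].
have thE j : tnth th j = theta j by rewrite tnth_mktuple.
have th0 : head 0 th = theta i0.
  by rewrite -thE (tnth_nth 0) i00 nth0.
have nth_th (k : nat) (kd : (k < d)%N) : nth 0 th k = theta (Ordinal kd).
  by rewrite -thE (tnth_nth 0).
(* On sorted phases, lying at or after the first phase beyond the threshold is the same as being
   beyond it, so the search by [find] becomes a test on [theta j] alone. *)
have rebE j : rebranch th j = reb j.
  rewrite /rebranch thE th0 /reb.
  set p := fun x => _.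
  have jd : (j < size th)%N by rewrite size_tuple.
  have dP : (d.-1 < d)%N by rewrite ltn_predL (leq_ltn_trans _ (ltn_ord j)).
  have lastE : last 0 th = theta (Ordinal dP).
    by rewrite -nth_last size_tuple -nth_th.
  (* If [j] passes the test, [find] stops no later than [j], and the last phase passes by
     monotonicity. *)
  case: (boolP (pi <= theta j - theta i0)) => pj.
    have -> : (find p th <= j)%N.
      rewrite leqNgt; apply/negP => /(before_find 0).
      by rewrite -tnth_nth thE /p pj.
    rewrite ifT // andbT lastE (le_trans pj) // lerB // thetale //=.
    by rewrite -ltnS prednK // (leq_ltn_trans _ (ltn_ord j)).
  (* Conversely, the phase where [find] stops passes the test, hence so does every later one. *)
  rewrite ifF //; apply/negbTE; apply: contra pj => /andP[_ kj].
  have kth : (find p th < size th)%N by exact: leq_ltn_trans jd.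
  have := kth; rewrite -has_find => /(nth_find 0).
  have kd : (find p th < d)%N by rewrite size_tuple in kth.
  rewrite (nth_th _ kd) /p => /le_trans; apply.
  by rewrite lerB // thetale.
exists Q', th, (reb jmax); split.
(* Permuting columns only reorders the sums defining the entries of [Q Q^dagger]. *)
- apply/unitarymxP/matrixP => a b; have /unitarymxP/matrixP/(_ a b) := Qu.
  rewrite !mxE => <-; rewrite [RHS](reindex_inj sinj) /=.
  by apply: eq_bigr => k _; rewrite !mxE.
- rewrite GTE conjE; apply/matrixP => a b; rewrite !mxE (reindex_inj sinj) /=.
  apply: eq_bigr => k _; rewrite thE cargK // !mxE; congr (_ * _).
  rewrite (bigD1 (s k)) //= big1 ?addr0 // => l lk.
  by move/is_diag_mxP: Td => -> //; rewrite mulr0.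
- split.
    apply/(sortedP 0) => i; rewrite size_tuple => id.
    by rewrite (nth_th _ id) (nth_th _ (ltnW id)) thetale /=.
  apply/allP => x /tnthP[j ->]; rewrite thE; exact: carg_bounds.
- by split; [exists jmax; rewrite rebE|move=> j; rewrite rebE].
rewrite conjE; apply/matrixP => a b; rewrite !mxE; congr (_ * _).
by apply: eq_bigr => k _; rewrite rebE.
Qed.

End HamiltonianStep.

(** * Programs and their triples *)

Fixpoint bind (nf ns : nat -> nat) A B (p : prog nf ns A)
    (k : A -> prog nf ns B) : prog nf ns B :=
  match p with
  | Ret a => k a
  | Do o args f => Do args (fun r => bind (f r) k)
  | TestLe x y f => TestLe x y (fun b => bind (f b) k)
  end.

Notation "'let*' x := p 'in' q" := (bind p (fun x => q))
  (at level 200, x name, p at level 100, q at level 200).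

Section Programs.
Variables nf ns : nat -> nat.
Local Notation prog := (prog nf ns).

Definition call (o : op) (args : 'rV[addr]_(in_size nf ns o)) :
  prog 'rV[addr]_(out_size ns o) := Do args (@Ret nf ns _).

Definition row2 (x y : addr) : 'rV[addr]_2 :=
  \row_i (if i == ord0 then x else y).

Definition call_zero : prog addr :=
  let* r := @call Zero (const_mx 0%N) in Ret _ _ (r 0 0).
Definition call_one : prog addr :=
  let* r := @call One (const_mx 0%N) in Ret _ _ (r 0 0).
Definition call_i : prog addr :=
  let* r := @call ImagUnit (const_mx 0%N) in Ret _ _ (r 0 0).
Definition call_pi : prog addr :=
  let* r := @call Pi (const_mx 0%N) in Ret _ _ (r 0 0).
Definition call_add x y : prog addr :=
  let* r := @call Add (row2 x y) in Ret _ _ (r 0 0).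
Definition call_sub x y : prog addr :=
  let* r := @call Defs.Sub (row2 x y) in Ret _ _ (r 0 0).
Definition call_mul x y : prog addr :=
  let* r := @call Mul (row2 x y) in Ret _ _ (r 0 0).
Definition call_div x y : prog addr :=
  let* r := @call Div (row2 x y) in Ret _ _ (r 0 0).
Definition call_conj x : prog addr :=
  let* r := @call Conj (const_mx x) in Ret _ _ (r 0 0).
Definition call_sqrt x : prog addr :=
  let* r := @call Sqrt (const_mx x) in Ret _ _ (r 0 0).
Definition call_arg x : prog addr :=
  let* r := @call Arg (const_mx x) in Ret _ _ (r 0 0).
Definition call_test x y : prog bool := TestLe x y (@Ret nf ns _).

(** [a0] is a filler, returned only for indices outside [s]. *)
Fixpoint tabulate_seq (I : eqType) A (a0 : A) (f : I -> prog A) (s : seq I) :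
    prog (I -> A) :=
  if s is i :: s' then
    let* a := f i in let* g := tabulate_seq a0 f s' in
    Ret _ _ (fun j => if j == i then a else g j)
  else Ret _ _ (fun _ => a0).

Definition tabulate (I : finType) A (a0 : A) (f : I -> prog A) : prog (I -> A) :=
  tabulate_seq a0 f (enum I).

(** Sorting and maximization only need the table of all pairwise comparisons;
  given that table they are address manipulations, hence free. *)
Definition compare_all (I : finType) (x : I -> addr) : prog (I * I -> bool) :=
  tabulate false (fun ij : I * I => call_test (x ij.1) (x ij.2)).

Fixpoint sum_seq (I : Type) (x : I -> addr) (s : seq I) : prog addr :=
  if s is i :: s' then let* y := sum_seq x s' in call_add (x i) y
  else call_zero.

Definition sum_all (I : finType) (x : I -> addr) : prog addr :=
  sum_seq x (enum I).

End Programs.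

(** * Cost-bounded triples for programs *)

Section Logic.
Variables (R : realType) (nf ns : nat -> nat) (O : oracles R nf ns) (w : costs).
Notation C := R[i].
Local Notation prog := (prog nf ns).
Implicit Types m : memory R.

Lemma exec_bind A B (p : prog A) (k : A -> prog B) m :
  exec O w (bind p k) m =
  let: (a, m1, c1) := exec O w p m in
  let: (b, m2, c2) := exec O w (k a) m1 in (b, m2, (c1 + c2)%N).
Proof.
elim: p m => [a|o args f IH|x y f IH] m /=.
- by case: (exec _ _ _ _) => -[].
- rewrite IH; case: (exec _ _ _ _) => -[a m1] c1.
  by case: (exec _ _ _ _) => -[b m2] c2; rewrite addnA.
- rewrite IH; case: (exec _ _ _ _) => -[a m1] c1.
  by case: (exec _ _ _ _) => -[b m2] c2.
Qed.

Definition extends m m' := exists s, m' = m ++ s.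

Lemma extends_refl m : extends m m.
Proof. by exists [::]; rewrite cats0. Qed.

Lemma extends_trans m1 m2 m3 : extends m1 m2 -> extends m2 m3 -> extends m1 m3.
Proof. by move=> [s ->] [s' ->]; exists (s ++ s'); rewrite catA. Qed.

(** The bound on [x] matters: past the end [nth] reads 0, and such a reading need not survive an
    extension of the memory. *)
Definition holds m (x : addr) (v : C) := (x < size m)%N /\ nth 0 m x = v.

Definition holds_all I m (x : I -> addr) (v : I -> C) :=
  forall i, holds m (x i) (v i).

Definition stored p q m (a : 'M[addr]_(p, q)) (A : 'M[C]_(p, q)) :=
  forall i j, holds m (a i j) (A i j).

Definition stored_all I p q m (a : I -> 'M[addr]_(p, q)) (A : I -> 'M[C]_(p, q)) :=
  forall i, stored m (a i) (A i).

Lemma holds_extends m m' x v : extends m m' -> holds m x v -> holds m' x v.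
Proof.
move=> [s ->] [xm <-]; split; last by rewrite nth_cat xm.
by rewrite size_cat ltn_addr.
Qed.

Lemma holds_all_extends I m m' (x : I -> addr) v :
  extends m m' -> holds_all m x v -> holds_all m' x v.
Proof. by move=> e h i; apply: holds_extends e _. Qed.

Lemma stored_extends p q m m' (a : 'M[addr]_(p, q)) A :
  extends m m' -> stored m a A -> stored m' a A.
Proof. by move=> e h i j; apply: holds_extends e _. Qed.

Lemma stored_all_extends I p q m m' (a : I -> 'M[addr]_(p, q)) A :
  extends m m' -> stored_all m a A -> stored_all m' a A.
Proof. by move=> e h i; exact: stored_extends e (h i). Qed.

Lemma stored_load p q m (a : 'M[addr]_(p, q)) A : stored m a A -> load m a = A.
Proof. by move=> h; apply/matrixP => i j; rewrite mxE; case: (h i j). Qed.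

Lemma stored_store m n (v : 'rV[C]_n) : stored (store m v) (new_cells m n) v.
Proof.
move=> i j; rewrite /store mxE ord1; split.
  by rewrite size_cat size_map size_enum_ord ltn_add2l.
rewrite nth_cat ltnNge leq_addr /= addKn (nth_map j) ?size_enum_ord //.
by rewrite nth_ord_enum.
Qed.

(** A Hoare triple from a fixed starting memory, with a cost bound. The conjunct [extends m m'] lets
    facts about [m] be carried past [p]. *)
Definition runs A m (p : prog A) (c : nat) (Q : A -> memory R -> Prop) : Prop :=
  let: (a, m', c') := exec O w p m in [/\ extends m m', Q a m' & (c' <= c)%N].

Lemma runs_weaken A m (p : prog A) c c' (Q Q' : A -> memory R -> Prop) :
  runs m p c Q -> (c <= c')%N -> (forall a m', Q a m' -> Q' a m') ->
  runs m p c' Q'.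
Proof.
rewrite /runs; case: (exec _ _ _ _) => -[a m'] c1 [e q le] cc' QQ'.
by split=> //; [exact: QQ'|exact: leq_trans cc'].
Qed.

Lemma runs_ret A m (a : A) c (Q : A -> memory R -> Prop) :
  Q a m -> runs m (Ret nf ns a) c Q.
Proof. by move=> q; split=> //; exact: extends_refl. Qed.

(** The continuation is verified from every extension satisfying [Q1], so the intermediate memory
    stays abstract. *)
Lemma runs_bind A B m (p : prog A) (k : A -> prog B) c1 c2 Q1 Q2 :
  runs m p c1 Q1 ->
  (forall a m', extends m m' -> Q1 a m' -> runs m' (k a) c2 Q2) ->
  runs m (bind p k) (c1 + c2) Q2.
Proof.
rewrite /runs exec_bind; case: (exec _ _ _ _) => -[a m1] d1 [e1 q1 le1].
move=> /(_ a m1 e1 q1); case: (exec _ _ _ _) => -[b m2] d2 [e2 q2 le2].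
by split=> //; [exact: extends_trans e2|exact: leq_add].
Qed.

(** Free rearrangement of a result; avoids a trailing [+ 0] in the cost. *)
Lemma runs_bind_ret A B m (p : prog A) (f : A -> B) c Q1 Q2 :
  runs m p c Q1 -> (forall a m', Q1 a m' -> Q2 (f a) m') ->
  runs m (let* x := p in Ret nf ns (f x)) c Q2.
Proof.
move=> h1 h2; rewrite -[c]addn0; apply: runs_bind h1 _ => a m' _ q.
by apply: runs_ret; exact: h2.
Qed.

Lemma runs_call m o (args : 'rV[addr]_(in_size nf ns o)) X :
  stored m args X ->
  runs m (call args) (op_cost w o) (fun r m' => stored m' r (run_op O X)).
Proof.
move=> /stored_load <-; rewrite /runs /=; split; first by eexists; reflexivity.
  exact: stored_store.
by rewrite addn0.
Qed.

Lemma stored0 p m (a : 'M[addr]_(p, 0)) A : stored m a A.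
Proof. by move=> i []. Qed.

Lemma stored_row2 m x y u v : holds m x u -> holds m y v ->
  stored m (row2 x y) (\row_i (if i == ord0 then u else v)).
Proof. by move=> hx hy i j; rewrite !mxE; case: eqP. Qed.

Lemma stored_const p q m x u : holds m x u ->
  stored m (const_mx x : 'M[addr]_(p, q)) (const_mx u).
Proof. by move=> hx i j; rewrite !mxE. Qed.

Lemma runs_zero m : runs m (call_zero nf ns) 1 (fun r m' => holds m' r 0).
Proof.
apply: runs_bind_ret (@runs_call m Zero _ 0 (@stored0 _ _ _ _)) _ => r m' h.
by have := h 0 0; rewrite /= mxE.
Qed.

Lemma runs_one m : runs m (call_one nf ns) 1 (fun r m' => holds m' r 1).
Proof.
apply: runs_bind_ret (@runs_call m One _ 0 (@stored0 _ _ _ _)) _ => r m' h.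
by have := h 0 0; rewrite /= mxE.
Qed.

Lemma runs_i m : runs m (call_i nf ns) 1 (fun r m' => holds m' r 'i).
Proof.
apply: runs_bind_ret (@runs_call m ImagUnit _ 0 (@stored0 _ _ _ _)) _ => r m' h.
by have := h 0 0; rewrite /= mxE.
Qed.

Lemma runs_pi m :
  runs m (call_pi nf ns) 1 (fun r m' => holds m' r (real_complex R pi)).
Proof.
apply: runs_bind_ret (@runs_call m Pi _ 0 (@stored0 _ _ _ _)) _ => r m' h.
by have := h 0 0; rewrite /= mxE.
Qed.

Section Arithmetic.
Variables (m : memory R) (x y : addr) (u v : C).
Hypotheses (hx : holds m x u) (hy : holds m y v).

Lemma runs_add :
  runs m (call_add nf ns x y) 1 (fun r m' => holds m' r (u + v)).
Proof.
apply: runs_bind_ret (@runs_call m Add _ _ (stored_row2 hx hy)) _ => r m' h.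
by have := h 0 0; rewrite /= !mxE.
Qed.

Lemma runs_sub :
  runs m (call_sub nf ns x y) 1 (fun r m' => holds m' r (u - v)).
Proof.
apply: runs_bind_ret (@runs_call m Defs.Sub _ _ (stored_row2 hx hy)) _ => r m' h.
by have := h 0 0; rewrite /= !mxE.
Qed.

Lemma runs_mul :
  runs m (call_mul nf ns x y) 1 (fun r m' => holds m' r (u * v)).
Proof.
apply: runs_bind_ret (@runs_call m Mul _ _ (stored_row2 hx hy)) _ => r m' h.
by have := h 0 0; rewrite /= !mxE.
Qed.

Lemma runs_div :
  runs m (call_div nf ns x y) 1 (fun r m' => holds m' r (u / v)).
Proof.
apply: runs_bind_ret (@runs_call m Div _ _ (stored_row2 hx hy)) _ => r m' h.
by have := h 0 0; rewrite /= !mxE.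
Qed.

Lemma runs_conj :
  runs m (call_conj nf ns x) 1 (fun r m' => holds m' r u^*).
Proof.
apply: runs_bind_ret (@runs_call m Conj _ _ (stored_const hx)) _ => r m' h.
by have := h 0 0; rewrite /= !mxE.
Qed.

Lemma runs_sqrt :
  runs m (call_sqrt nf ns x) 1 (fun r m' => holds m' r (sqrtC u)).
Proof.
apply: runs_bind_ret (@runs_call m Sqrt _ _ (stored_const hx)) _ => r m' h.
by have := h 0 0; rewrite /= !mxE.
Qed.

Lemma runs_arg :
  runs m (call_arg nf ns x) 1
    (fun r m' => holds m' r (real_complex R (carg u))).
Proof.
apply: runs_bind_ret (@runs_call m Arg _ _ (stored_const hx)) _ => r m' h.
by have := h 0 0; rewrite /= !mxE.
Qed.

Lemma runs_test :
  runs m (call_test nf ns x y) 1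
    (fun b _ => b = (complex.Re u <= complex.Re v)).
Proof.
by case: hx hy => _ <- [_ <-]; split=> //; exact: extends_refl.
Qed.

End Arithmetic.

(** Each [Q i] must be stable under extension because results computed early have to remain valid
    while the later ones are computed. *)
Lemma runs_tabulate (I : finType) A (a0 : A) (f : I -> prog A) m c
    (Q : I -> A -> memory R -> Prop) :
  (forall i a m1 m2, extends m1 m2 -> Q i a m1 -> Q i a m2) ->
  (forall i m', extends m m' -> runs m' (f i) c (Q i)) ->
  runs m (tabulate a0 f) (#|I| * c) (fun g m' => forall i, Q i (g i) m').
Proof.
move=> Qmono Hf; rewrite /tabulate cardE.
suff H s : forall m', extends m m' ->
    runs m' (tabulate_seq a0 f s) (size s * c)
      (fun g m'' => forall i, i \in s -> Q i (g i) m'').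
  apply: runs_weaken (H (enum I) m (extends_refl m)) _ _ => // g m' h i.
  by apply: h; rewrite mem_enum.
elim: s => [|i s IH] m1 e1 /=; first exact: runs_ret.
rewrite mulSn; apply: runs_bind (Hf i m1 e1) _ => a m2 e2 q2.
have h := IH _ (extends_trans e1 e2); rewrite -[(size s * c)%N]addn0.
apply: runs_bind h _ => g m3 e3 q3; apply: runs_ret => j.
rewrite in_cons; case: eqP => [->_|_ /= js]; last exact: q3.
exact: Qmono q2.
Qed.

Lemma runs_tabulate_holds (I : finType) (f : I -> prog addr) m c v :
  (forall i m', extends m m' ->
     runs m' (f i) c (fun x m'' => holds m'' x (v i))) ->
  runs m (tabulate 0%N f) (#|I| * c) (fun g m' => holds_all m' g v).
Proof. by apply: runs_tabulate => i a m1 m2; exact: holds_extends. Qed.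

Lemma runs_tabulate_ord n (f : 'I_n -> prog addr) m c v :
  (forall i m', extends m m' ->
     runs m' (f i) c (fun x m'' => holds m'' x (v i))) ->
  runs m (tabulate 0%N f) (n * c) (fun g m' => holds_all m' g v).
Proof. by rewrite -[in (n * c)%N](card_ord n); exact: runs_tabulate_holds. Qed.

Lemma runs_tabulate_pair p q (f : 'I_p * 'I_q -> prog addr) m c v :
  (forall ij m', extends m m' ->
     runs m' (f ij) c (fun x m'' => holds m'' x (v ij))) ->
  runs m (tabulate 0%N f) (p * q * c) (fun g m' => holds_all m' g v).
Proof.
rewrite -[in (p * q * c)%N](card_ord p) -[in (_ * q * c)%N](card_ord q).
by rewrite -card_prod; exact: runs_tabulate_holds.
Qed.

Lemma runs_compare_all n (x : 'I_n -> addr) v m :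
  holds_all m x v ->
  runs m (compare_all nf ns x) (n * n)
    (fun g _ => forall i j, g (i, j) = (complex.Re (v i) <= complex.Re (v j))).
Proof.
move=> hx; rewrite -[in (n * n)%N](card_ord n) -card_prod -[#|_|]muln1.
apply: runs_weaken (runs_tabulate (Q := fun ij b _ =>
  b = (complex.Re (v ij.1) <= complex.Re (v ij.2))) _ _ _) (leqnn _) _ => //.
  by move=> [i j] m' e; apply: runs_test; exact: holds_extends e (hx _).
Qed.

Lemma runs_sum_all n (x : 'I_n -> addr) v m :
  holds_all m x v ->
  runs m (sum_all nf ns x) (n + 1) (fun r m' => holds m' r (\sum_i v i)).
Proof.
move=> hx; rewrite -[in (n + 1)%N](card_ord n) /sum_all cardE -big_enum.
move: (enum 'I_n) => /= s.
elim: s => [|i s IH] /=; first by rewrite big_nil; exact: runs_zero.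
rewrite big_cons addSn -addn1; apply: runs_bind IH _ => y m' e hy.
exact: runs_add (holds_extends e (hx i)) hy.
Qed.

End Logic.

Arguments bind : simpl never.

(** * Maxima and sorting from a comparison table *)

Section Selection.
Variable R : realType.

(** [i0] is a junk value, reached only if [le] has no greatest element. *)
Definition greatest (I : finType) (i0 : I) (le : I * I -> bool) : I :=
  odflt i0 [pick i | [forall j, le (j, i)]].

Lemma greatestP (I : finType) (i0 : I) le (v : I -> R) :
  (forall i j, le (i, j) = (v i <= v j)) ->
  forall j, v j <= v (greatest i0 le).
Proof.
move=> leE j; rewrite /greatest; case: pickP => [i /forallP/(_ j)|/=].
  by rewrite leE.
(* A finite type inhabited by [i0] has a maximizer of [v], so the search cannot fail. *)
have [i _ imax] := @arg_maxP _ _ I i0 xpredT v isT.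
move=> /(_ i)/negP[]; apply/forallP => k; rewrite leE; exact: imax.
Qed.

(** The index placed at position [i] by sorting. The default of [nth] is never reached, as the list
    has [d] entries. *)
Definition sort_perm d (le : 'I_d * 'I_d -> bool) (i : 'I_d) : 'I_d :=
  nth i (sort (fun i j => le (i, j)) (enum 'I_d)) i.

Lemma sort_perm_inj d (le : 'I_d * 'I_d -> bool) : injective (sort_perm le).
Proof.
move=> i j; rewrite /sort_perm; set s := sort _ _.
have sz : size s = d by rewrite size_sort size_enum_ord.
have su : uniq s by rewrite sort_uniq enum_uniq.
(* The two sides use different defaults, which are first made equal. *)
rewrite (set_nth_default i j) ?sz // => /eqP.
by rewrite nth_uniq ?sz // => /eqP/val_inj.
Qed.

Lemma sort_perm_le d le (v : 'I_d -> R) :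
  (forall i j, le (i, j) = (v i <= v j)) ->
  forall i j : 'I_d, (i <= j)%N -> v (sort_perm le i) <= v (sort_perm le j).
Proof.
move=> leE i j ij; rewrite /sort_perm; set s := sort _ _.
have sz : size s = d by rewrite size_sort size_enum_ord.
rewrite (set_nth_default i j) ?sz // -leE.
have tot : total (fun i j => le (i, j)) by move=> a b; rewrite !leE le_total.
have tr : transitive (fun i j => le (i, j)).
  by move=> a b c; rewrite !leE; exact: le_trans.
have refl : reflexive (fun i j => le (i, j)) by move=> a; rewrite leE lexx.
by apply: (sorted_leq_nth tr refl i (sort_sorted tot _)); rewrite ?inE ?sz.
Qed.

End Selection.

(** * The program *)

Section TSOProgram.
Variables (nf ns : nat -> nat) (d' : nat).
Local Notation d := d'.+1.
Local Notation N := (d * d)%N.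
Local Notation prog := (prog nf ns).

(** Matches [init_mem], which lists the inputs in the order of [enum]. *)
Definition input_addr (x : input_index d nf) : addr := enum_rank x.

Definition reconstruct_all (off : 'rV[addr]_(ns d)) :
    prog (probe d -> 'M[addr]_d) :=
  tabulate (const_mx 0%N) (fun p =>
    let* r := @call nf ns (LREOnline d)
                (row_mx off (\row_i input_addr (inr (p, i)))) in
    Ret _ _ (vec_mx r)).

(** [ii] and [cc] are to hold [i] and [(1 + i) / 2]. [insub] succeeds exactly when [j != k]; a
    diagonal image is itself a reconstructed state and needs no arithmetic. *)
Definition Ehat_entry (ii cc : addr) (rec : probe d -> 'M[addr]_d)
    (x : ('I_d * 'I_d) * ('I_d * 'I_d)) : prog addr :=
  let: (jk, (a, b)) := x in
  match insub jk : option (distinct_pair d) with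
  | None => Ret _ _ (rec (inl (inl jk.1)) a b)
  | Some jk' =>
      let* im := call_mul nf ns ii (rec (inr jk') a b) in
      let* pm := call_add nf ns (rec (inl (inr jk')) a b) im in
      let* u := call_mul nf ns cc (rec (inl (inl jk.1)) a b) in
      let* v := call_mul nf ns cc (rec (inl (inl jk.2)) a b) in
      let* z := call_sub nf ns pm u in
      call_sub nf ns z v
  end.

Definition compute_Lambda (ii cc : addr) (rec : probe d -> 'M[addr]_d) :
    prog 'M[addr]_N :=
  let* g := tabulate 0%N (Ehat_entry ii cc rec) in
  Ret _ _ (\matrix_(x, y) g (unpair x, unpair y)).

(** The eigenvector is column [i] of [U]; reading it at the swapped index [mxvec_index ab.2 ab.1]
    performs [vec^-1]. *)
Definition compute_S (two : addr) (D : 'M[addr]_N) : prog 'M[addr]_d :=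
  let* h := tabulate 0%N (fun ij : 'I_N * 'I_N =>
    let* y := call_conj nf ns (D ij.2 ij.1) in call_add nf ns (D ij.1 ij.2) y) in
  let* r := @call nf ns (SpectralDec N) (mxvec (\matrix_(i, j) h (i, j))) in
  let U := vec_mx (lsubmx (r : 'rV_(N * N + N))) : 'M[addr]_N in
  let l := rsubmx (r : 'rV_(N * N + N)) in
  let* le := compare_all nf ns (fun i => l 0 i) in
  let i := greatest (mxvec_index ord0 ord0 : 'I_N) le in
  let* q := call_div nf ns (l 0 i) two in
  let* s := call_sqrt nf ns q in
  let* g := tabulate 0%N (fun ab : 'I_d * 'I_d =>
    call_mul nf ns s (U (mxvec_index ab.2 ab.1) i)) in
  Ret _ _ (\matrix_(a, b) g (a, b)).

Definition compute_G (S : 'M[addr]_d) : prog 'M[addr]_d :=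
  let* r := @call nf ns (PolarDec d) (mxvec S) in
  Ret _ _ (vec_mx (lsubmx (r : 'rV_(N + N)))).

(** On sorted phases, [k <= j] for the least [k] with
  [pi <= theta_k - theta_0] just means [pi <= theta_j - theta_0]. *)
Definition rebranch_phase (ppi tpi th0 th : addr) : prog addr :=
  let* z := call_sub nf ns th th0 in
  let* b := call_test nf ns ppi z in
  if b then call_sub nf ns th tpi else Ret _ _ th.

(** The matrix [coef * Q diag(bar) Q^dagger], with [O(n)] operations per entry. *)
Definition rotate (n : nat) (Q : 'M[addr]_(d, n)) (coef : addr)
    (bar : 'I_n -> addr) : prog 'M[addr]_d :=
  let* h := tabulate 0%N (fun ab : 'I_d * 'I_d =>
    let* e := tabulate 0%N (fun k =>
      let* x := call_mul nf ns (Q ab.1 k) (bar k) in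
      let* y := call_conj nf ns (Q ab.2 k) in
      call_mul nf ns x y) in
    let* s := sum_all nf ns e in
    call_mul nf ns coef s) in
  Ret _ _ (\matrix_(a, b) h (a, b)).

Definition compute_H (zero one two ppi h1 t : addr) (G : 'M[addr]_d) :
    prog 'M[addr]_d :=
  let* r := @call nf ns (SchurDec d) (mxvec G^T) in
  let Q := vec_mx (lsubmx (r : 'rV_(N + N))) : 'M[addr]_d in
  let T := vec_mx (rsubmx (r : 'rV_(N + N))) : 'M[addr]_d in
  let* th := tabulate 0%N (fun j => call_arg nf ns (T j j)) in
  let* le := compare_all nf ns th in
  let s := sort_perm le in
  let* tpi := call_mul nf ns two ppi in
  let* reb := tabulate 0%N (fun j =>
    rebranch_phase ppi tpi (th (s ord0)) (th (s j))) in
  let* le' := compare_all nf ns reb in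
  let jmax := greatest ord0 le' in
  let* h1t := call_mul nf ns h1 t in
  let* bar := tabulate 0%N (fun j =>
    let* z := call_sub nf ns (reb j) h1t in
    call_sub nf ns z (reb jmax)) in
  let* ti := call_div nf ns one t in
  let* coef := call_sub nf ns zero ti in
  rotate (\matrix_(a, k) Q a (s k)) coef bar.

(** The [d^8] entries of [B] all point to the two cells [zero] and [one], which is why writing [B]
    down is free. *)
Definition tso_program : prog (tso_result d addr) :=
  let* zero := call_zero nf ns in
  let* one := call_one nf ns in
  let* ii := call_i nf ns in
  let* ppi := call_pi nf ns in
  let* two := call_add nf ns one one in
  let* onei := call_add nf ns one ii in
  let* cc := call_div nf ns onei two in
  let* off := @call nf ns (LREOffline d) (const_mx 0%N) in
  let* rec := reconstruct_all off in
  let* L := compute_Lambda ii cc rec in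
  let D := matrix_D L in
  let* S := compute_S two D in
  let* G := compute_G S in
  let* H := compute_H zero one two ppi (input_addr (inl false))
              (input_addr (inl true)) G in
  Ret _ _ (TSOResult (matrix_B d zero one) L D S G H).

End TSOProgram.

(** Transports all recorded facts about the source memory of [e] to its target. *)
Ltac lift e :=
  match type of e with extends ?m _ =>
    repeat match goal with
    | H : holds m _ _ |- _ => apply (holds_extends e) in H
    | H : holds_all m _ _ |- _ => apply (holds_all_extends e) in H
    | H : stored m _ _ |- _ => apply (stored_extends e) in H
    | H : stored_all m _ _ |- _ => apply (stored_all_extends e) in H
    end
  end.

(** Bracketed like the binds of the programs, so that [runs_bind] applies. *)
Definition cost_S (w : costs) (d : nat) (N := (d * d)%N) : nat :=
  N * N * (1 + 1) + (spectral_cost w N + (N * N + (1 + (1 + N * 1)))).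

Definition cost_H (w : costs) (d : nat) : nat :=
  schur_cost w d + (d * 1 + (d * d + (1 + (d * (1 + (1 + 1)) + (d * d +
    (1 + (d * (1 + 1) + (1 + (1 +
      d * d * (d * (1 + (1 + 1)) + ((d + 1) + 1))))))))))).

(** * Triples for the steps of the method *)

Section TSOCorrect.
Variables (R : realType) (nf ns : nat -> nat) (O : oracles R nf ns) (w : costs).
Variable d' : nat.
Notation C := R[i].
Local Notation d := d'.+1.
Local Notation N := (d * d)%N.
Implicit Types m : memory R.

Lemma input_holds h1 t (freq : 'M[C]_d -> 'rV[R]_(nf d)) x :
  holds (init_mem h1 t freq) (input_addr x) (input_value h1 t freq x).
Proof.
rewrite /holds /init_mem /input_addr size_map -cardE; split=> //.
by rewrite (nth_map x) -?cardE // nth_enum_rank.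
Qed.

Lemma stored_mxvec p q m (a : 'M[addr]_(p, q)) A :
  stored m a A -> stored m (mxvec a) (mxvec A).
Proof.
by move=> h i j; rewrite ord1; case/mxvec_indexP: j => k l; rewrite !mxvecE.
Qed.

Lemma stored_vec_mx p q m (a : 'rV[addr]_(p * q)) A :
  stored m a A -> stored m (vec_mx a) (vec_mx A).
Proof. by move=> h i j; rewrite !mxE. Qed.

Lemma stored_trmx p q m (a : 'M[addr]_(p, q)) A : stored m a A -> stored m a^T A^T.
Proof. by move=> h i j; rewrite !mxE. Qed.

Lemma stored_row_mx p q1 q2 m (a : 'M[addr]_(p, q1)) (b : 'M[addr]_(p, q2)) A B :
  stored m a A -> stored m b B -> stored m (row_mx a b) (row_mx A B).
Proof. by move=> ha hb i j; rewrite !mxE; case: (fintype.split j). Qed.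

Lemma stored_lsubmx p q1 q2 m (a : 'M[addr]_(p, q1 + q2)) A B :
  stored m a (row_mx A B) -> stored m (lsubmx a) A.
Proof. by move=> h i j; rewrite -(row_mxEl A B) mxE. Qed.

Lemma stored_rsubmx p q1 q2 m (a : 'M[addr]_(p, q1 + q2)) A B :
  stored m a (row_mx A B) -> stored m (rsubmx a) B.
Proof. by move=> h i j; rewrite -(row_mxEr A B) mxE. Qed.

Lemma runs_reconstruct_all h1 t (freq : 'M[C]_d -> 'rV[R]_(nf d)) m off :
  extends (init_mem h1 t freq) m -> stored m off (lre_offline O d) ->
  runs O w m (reconstruct_all nf off) (#|{: probe d}| * lre_online_cost w d)
    (fun g m' => stored_all m' g (fun p => reconstruct O freq (probe_state R p))).
Proof.
move=> e0 hoff.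
apply: (@runs_tabulate _ _ _ _ _ _ _ _ _ _ _ (fun p a m' =>
    stored m' a (reconstruct O freq (probe_state R p)))) => [p a m1 m2|p m' e].
  exact: stored_extends.
have e1 := extends_trans e0 e; lift e.
have hfreq : stored m' (\row_i input_addr (inr (p, i)))
    (map_mx (real_complex R) (freq (probe_state R p))).
  by move=> i j; rewrite !mxE ord1; apply: holds_extends e1 (input_holds _ _ _ _).
apply: runs_bind_ret (@runs_call _ _ _ O w m' (LREOnline d) _ _
                        (stored_row_mx hoff hfreq)) _ => r m'' h.
rewrite -[reconstruct _ _ _]mxvecK; apply: stored_vec_mx.
by move: h; rewrite /= row_mxKl row_mxKr.
Qed.

Lemma runs_Ehat_entry freq m ii cc (rec : probe d -> 'M[addr]_d) x :
  holds m ii 'i -> holds m cc ((1 + 'i) / 2) ->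
  stored_all m rec (fun p => reconstruct O freq (probe_state R p)) ->
  runs O w m (Ehat_entry nf ns ii cc rec x) (1 + (1 + (1 + (1 + (1 + 1)))))
    (fun r m' => holds m' r (Ehat O freq x.1.1 x.1.2 x.2.1 x.2.2)).
Proof.
case: x => -[j k] [a b] hii hcc hrec; rewrite /Ehat_entry /Ehat /=.
case: insubP => [jk /= jk1 jk2|]; last first.
  rewrite negbK /= => ->; apply: runs_ret; exact: (hrec (inl (inl j)) a b).
rewrite (negPf jk1) !mxE.
have hm := hrec (inr jk) a b; have hp := hrec (inl (inr jk)) a b.
have hj := hrec (inl (inl j)) a b; have hk := hrec (inl (inl k)) a b.
rewrite /= jk2 /= in hm hp hj hk.
apply: runs_bind (runs_mul _ _ hii hm) _ => im m1 e1 him; lift e1.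
apply: runs_bind (runs_add _ _ hp him) _ => pm m2 e2 hpm; lift e2.
apply: runs_bind (runs_mul _ _ hcc hj) _ => u m3 e3 hu; lift e3.
apply: runs_bind (runs_mul _ _ hcc hk) _ => v m4 e4 hv; lift e4.
apply: runs_bind (runs_sub _ _ hpm hu) _ => z m5 e5 hz; lift e5.
exact: runs_sub.
Qed.

Lemma runs_compute_Lambda freq m ii cc (rec : probe d -> 'M[addr]_d) :
  holds m ii 'i -> holds m cc ((1 + 'i) / 2) ->
  stored_all m rec (fun p => reconstruct O freq (probe_state R p)) ->
  runs O w m (compute_Lambda nf ns ii cc rec) (N * N * 6)
    (fun a m' => exists2 L, stored m' a L & is_Lambda O freq L).
Proof.
move=> hii hcc hrec.
(* The table is indexed by the four basis indices [((j, k), (a, b))], with at most six operations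
   per entry. *)
have -> : (N * N = #|{: ('I_d * 'I_d) * ('I_d * 'I_d)}|)%N.
  by rewrite !card_prod card_ord.
apply: runs_bind_ret (runs_tabulate_holds _) _.
  move=> x m' e; lift e; exact: runs_Ehat_entry.
move=> g m' hg; exists (\matrix_(x, y) Ehat O freq (unpair x).1 (unpair x).2
                                      (unpair y).1 (unpair y).2).
  by move=> x y; rewrite !mxE; exact: (hg (_, _)).
by apply: is_LambdaP => j k a b; rewrite mxE !mxvec_indexK.
Qed.

Lemma runs_compute_S m two (aD : 'M[addr]_N) D :
  holds m two 2 -> stored m aD D ->
  runs O w m (compute_S nf ns two aD)
    (cost_S w d)
    (fun a m' => exists2 S, stored m' a S & is_S D S).
Proof.
move=> htwo hD; rewrite /cost_S.
apply: runs_bind (runs_tabulate_pair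
  (v := fun ij => D ij.1 ij.2 + (D ij.2 ij.1)^*) _) _.
  move=> ij m' e; lift e.
  apply: runs_bind (runs_conj _ _ (hD _ _)) _ => y m1 e1 hy; lift e1.
  exact: runs_add (hD _ _) hy.
move=> h m1 e1 hh; lift e1.
have hH : stored m1 (\matrix_(i, j) h (i, j)) (D + D^t*).
  by move=> i j; rewrite !mxE; exact: (hh (i, j)).
apply: runs_bind (@runs_call _ _ _ O w m1 (SpectralDec N) _ _ (stored_mxvec hH)) _.
move=> r m2 e2; lift e2; rewrite /= mxvecK.
(* The oracle is specified on Hermitian matrices only, which [D + D^dagger] is. *)
have := spectral_decP O (add_adjoint_hermitian D).
case: (spectral_dec _ _) => U l /= spec hr.
have hU := stored_vec_mx (stored_lsubmx hr); rewrite mxvecK in hU.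
have hl := stored_rsubmx hr.
have hl0 : holds_all m2 (fun i => rsubmx (r : 'rV_(N * N + N)) 0 i) (l 0).
  by move=> i; exact: hl.
apply: runs_bind (runs_compare_all _ _ hl0) _ => le m3 e3 leE; lift e3.
set i := greatest _ _.
have imax : forall j, complex.Re (l 0 j) <= complex.Re (l 0 i).
  exact: (greatestP _ (v := fun j => complex.Re (l 0 j))).
apply: runs_bind (runs_div _ _ (hl0 i) htwo) _ => q m4 e4 hq; lift e4.
apply: runs_bind (runs_sqrt _ _ hq) _ => s m5 e5 hs; lift e5.
apply: runs_bind_ret (runs_tabulate_pair _) _.
  move=> ab m' e /=; lift e; exact: runs_mul hs (hU _ _).
move=> g m6 hg; exists (sqrtC (l 0 i / 2) *: unvec (col i U)).
  by move=> a b; rewrite mxE [X in holds _ _ X]mxE unvecE mxE; exact: (hg (a, b)).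
exact: is_S_of_spectral.
Qed.

(** Unitarity of [G] is recorded next to [is_G] because the Schur step relies on it. *)
Lemma runs_compute_G m (aS : 'M[addr]_d) S : stored m aS S ->
  runs O w m (compute_G nf ns aS) (polar_cost w d)
    (fun a m' => exists2 G, stored m' a G & is_G S G /\ G \is unitarymx).
Proof.
move=> hS.
apply: runs_bind_ret (@runs_call _ _ _ O w m (PolarDec d) _ _ (stored_mxvec hS)) _.
move=> r m1; rewrite /= mxvecK.
have := polar_decP O S; case: (polar_dec _ _) => G P /= pol hr.
exists G; first by rewrite -[G]mxvecK; exact: stored_vec_mx (stored_lsubmx hr).
by split; [exact: is_G_of_polar pol|case: pol].
Qed.

Lemma runs_rebranch_phase m ppi tpi th0 th (x0 x : R) :
  holds m ppi (real_complex R pi) -> holds m tpi (real_complex R (2 * pi)) ->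
  holds m th0 (real_complex R x0) -> holds m th (real_complex R x) ->
  runs O w m (rebranch_phase nf ns ppi tpi th0 th) (1 + (1 + 1))
    (fun r m' => holds m' r
       (real_complex R (if pi <= x - x0 then x - 2 * pi else x))).
Proof.
move=> hpi htpi hx0 hx.
apply: runs_bind (runs_sub _ _ hx hx0) _ => z m1 e1 hz; lift e1.
(* Writes the stored difference as the image of one real number, whose real part the test then
   reads. *)
rewrite -rmorphB in hz.
apply: runs_bind (runs_test _ _ hpi hz) _ => b m2 e2 -> /=; lift e2.
case: ifP => _; last exact: runs_ret.
by rewrite rmorphB; exact: runs_sub.
Qed.

Lemma runs_rotate n m (aQ : 'M[addr]_(d, n)) Q coef c bar b :
  stored m aQ Q -> holds m coef c -> holds_all m bar b ->
  runs O w m (rotate nf ns aQ coef bar)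
    (N * (n * (1 + (1 + 1)) + ((n + 1) + 1)))
    (fun a m' => stored m' a
       (\matrix_(x, y) (c * \sum_k Q x k * b k * (Q y k)^*))).
Proof.
move=> hQ hc hb.
apply: runs_bind_ret (runs_tabulate_pair
  (v := fun xy => c * \sum_k Q xy.1 k * b k * (Q xy.2 k)^*) _) _; last first.
  by move=> g m' hg x y; rewrite !mxE; exact: (hg (x, y)).
move=> xy m1 e1 /=; lift e1.
apply: runs_bind (runs_tabulate_ord _) _.
  move=> k m2 e2; lift e2.
  apply: runs_bind (runs_mul _ _ (hQ xy.1 k) (hb k)) _ => x m3 e3 hx; lift e3.
  apply: runs_bind (runs_conj _ _ (hQ xy.2 k)) _ => y m4 e4 hy; lift e4.
  exact: runs_mul hx hy.
move=> e m2 e2 he; lift e2.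
apply: runs_bind (runs_sum_all _ _ he) _ => s m3 e3 hs; lift e3.
exact: runs_mul hc hs.
Qed.

Lemma runs_compute_H m zero one two ppi ah1 at_ (aG : 'M[addr]_d) (h1 t : R) G :
  holds m zero 0 -> holds m one 1 -> holds m two 2 ->
  holds m ppi (real_complex R pi) ->
  holds m ah1 (real_complex R h1) -> holds m at_ (real_complex R t) ->
  stored m aG G -> G \is unitarymx ->
  runs O w m (compute_H nf ns zero one two ppi ah1 at_ aG)
    (cost_H w d)
    (fun a m' => exists2 H, stored m' a H & is_H h1 t G H).
Proof.
move=> h0 hone h2 hpi hh1 ht hG Gu.
have hGT := stored_trmx hG; rewrite /cost_H.
apply: runs_bind (@runs_call _ _ _ O w m (SchurDec d) _ _ (stored_mxvec hGT)) _.
move=> r m1 e1; lift e1; rewrite /= mxvecK.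
have := schur_decP O G^T; case: (schur_dec _ _) => Q T /= sch hr.
have hQ := stored_vec_mx (stored_lsubmx hr); rewrite mxvecK in hQ.
have hT := stored_vec_mx (stored_rsubmx hr); rewrite mxvecK in hT.
move: (vec_mx _) (vec_mx _) hQ hT => aT aQ hQ hT.
apply: runs_bind (runs_tabulate_ord _) _.
  move=> j m2 e2; lift e2; exact: runs_arg (hT j j).
move=> th m2 e2 hth; lift e2.
apply: runs_bind (runs_compare_all _ _ hth) _ => le m3 e3 leE; lift e3.
set s := sort_perm le.
apply: runs_bind (runs_mul _ _ h2 hpi) _ => tpi m4 e4 htpi; lift e4.
have htpi' : holds m4 tpi (real_complex R (2 * pi)) by rewrite rmorphM rmorph_nat.
apply: runs_bind (runs_tabulate_ord _) _.
  move=> j m5 e5; lift e5.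
  exact: runs_rebranch_phase hpi htpi' (hth (s ord0)) (hth (s j)).
move=> reb m5 e5 hreb; lift e5.
apply: runs_bind (runs_compare_all _ _ hreb) _ => le' m6 e6 leE'; lift e6.
set jmax := greatest _ le'.
apply: runs_bind (runs_mul _ _ hh1 ht) _ => h1t m7 e7 hh1t; lift e7.
apply: runs_bind (runs_tabulate_ord _) _.
  move=> j m8 e8; lift e8.
  apply: runs_bind (runs_sub _ _ (hreb j) hh1t) _ => z m9 e9 hz; lift e9.
  exact: runs_sub hz (hreb jmax).
move=> bar m8 e8 hbar; lift e8.
apply: runs_bind (runs_div _ _ hone ht) _ => ti m9 e9 hti; lift e9.
apply: runs_bind (runs_sub _ _ h0 hti) _ => coef m10 e10 hcoef; lift e10.
have hQs : stored m10 (\matrix_(a, k) aQ a (s k)) (\matrix_(a, k) Q a (s k)).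
  by move=> a k; rewrite !mxE.
apply: runs_weaken (runs_rotate hQs hcoef hbar) (leqnn _) _ => a m11 ha.
eexists; first exact: ha.
pose theta j := carg (T (s j) (s j)).
pose rb j := if pi <= theta j - theta ord0 then theta j - 2 * pi else theta j.
(* The machine forms [0 - 1 / t] and complex differences; these are brought to the real form
   expected by [is_H_of_schur]. *)
rewrite [X in is_H _ _ _ X](_ : _ =
    \matrix_(a, b) (- (real_complex R t)^-1 *
      \sum_k Q a (s k) * real_complex R (rb k - h1 * t - rb jmax)
              * (Q b (s k))^*)); last first.
  apply/matrixP => x y; rewrite !mxE sub0r mul1r; congr (_ * _).
  by apply: eq_bigr => k _; rewrite !mxE !rmorphB rmorphM.
apply: is_H_of_schur => //; first exact: sort_perm_inj.
- move=> i j; apply: (sort_perm_le (v := fun j => carg (T j j))).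
  by move=> i1 j1; rewrite leE.
- by apply: (greatestP _ (v := rb)) => i j; rewrite leE'.
Qed.

End TSOCorrect.

Lemma stored_matrix_B (R : realType) d (m : memory R) zero one :
  holds m zero 0 -> holds m one 1 ->
  stored m (matrix_B d zero one) (matrix_B d 0 1).
Proof.
move=> h0 h1 r c; rewrite !mxE; case: (unpair r) => n k; case: (unpair c) => i j.
by case: ifP.
Qed.

Lemma stored_matrix_D (R : realType) d (m : memory R) (aL : 'M[addr]_(d * d)) L :
  stored m aL L -> stored m (matrix_D aL) (matrix_D L).
Proof. by move=> h i j; rewrite !mxE. Qed.

Lemma runs_tso_program (R : realType) nf ns (O : oracles R nf ns) (w : costs) d'
    (d := d'.+1) h1 t (freq : 'M[R[i]]_d -> 'rV[R]_(nf d)) :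
  runs O w (init_mem h1 t freq) (tso_program nf ns d')
   (1 + (1 + (1 + (1 + (1 + (1 + (1 + (lre_offline_cost w d +
     (#|{: probe d}| * lre_online_cost w d +
     (d * d * (d * d) * 6 +
     (cost_S w d + (polar_cost w d + cost_H w d))))))))))))
    (fun r m' => tso_run O freq h1 t (load_result m' r)).
Proof.
set m := init_mem h1 t freq.
have hh1 := input_holds h1 t freq (inl false) : holds m _ (real_complex R h1).
have ht := input_holds h1 t freq (inl true) : holds m _ (real_complex R t).
have e0 : extends m m := extends_refl m.
apply: runs_bind (runs_zero O w m) _ => zero m1 e1 h0; lift e1.
apply: runs_bind (runs_one O w m1) _ => one m2 e2 hone; lift e2.
apply: runs_bind (runs_i O w m2) _ => ii m3 e3 hi; lift e3.
apply: runs_bind (runs_pi O w m3) _ => ppi m4 e4 hpi; lift e4.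
apply: runs_bind (runs_add _ _ hone hone) _ => two m5 e5 h2; lift e5.
apply: runs_bind (runs_add _ _ hone hi) _ => onei m6 e6 honei; lift e6.
apply: runs_bind (runs_div _ _ honei h2) _ => cc m7 e7 hcc; lift e7.
apply: runs_bind (@runs_call _ _ _ O w m7 (LREOffline d) _ 0
  (@stored0 _ _ _ _ _)) _ => off m8 e8 hoff; lift e8.
(* The frequencies are read from the initial memory, which is still a prefix of the current one. *)
have em : extends m m8.
  by do 8 (apply: extends_trans; last by eassumption); exact: extends_refl.
apply: runs_bind (runs_reconstruct_all w em hoff) _ => rec m9 e9 hrec; lift e9.
apply: runs_bind (runs_compute_Lambda w hi hcc hrec) _.
move=> aL m10 e10 [L hL Lspec]; lift e10.
have hD := stored_matrix_D hL.
apply: runs_bind (runs_compute_S O w h2 hD) _ => aS m11 e11 [S hS Sspec]; lift e11.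
apply: runs_bind (runs_compute_G O w hS) _.
move=> aG m12 e12 [G hG [Gspec Gu]]; lift e12.
rewrite -[cost_H w _]addn0.
apply: runs_bind (runs_compute_H O w h0 hone h2 hpi hh1 ht hG Gu) _.
move=> aH m13 e13 [H hH Hspec]; lift e13.
have hB := stored_matrix_B (d := d) h0 hone.
apply: runs_ret; rewrite /tso_run /load_result /=.
rewrite (stored_load hB) (stored_load hL) (stored_load hD) (stored_load hS).
rewrite (stored_load hG) (stored_load hH) matrix_DP.
by split=> //; exact: is_B_matrix_B.
Qed.

(** * Asymptotics *)

Lemma isOP (R : realType) (f g : nat -> nat) : isO R f g <->
  exists C K : nat, forall n, (K <= n)%N -> (f n <= C * g n)%N.
Proof.
split.
  (* [Num.bound k] is a natural number above the real constant [k]. *)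
  move=> /eqO_exP[k k0 [K _ H]]; exists (Num.bound k), K => n /H /=.
  rewrite !normr_nat -(ler_nat R) natrM => /le_trans; apply.
  by rewrite ler_wpM2r // ltW // archi_boundP // ltW.
(* The successor makes the constant positive even if [C = 0]. *)
move=> [C [K H]]; apply/eqO_exP; exists C.+1%:R; first by rewrite ltr0n.
exists K => // n /H le /=; rewrite !normr_nat -natrM ler_nat.
by apply: leq_trans le _; rewrite leq_mul2r leqnSn orbT.
Qed.

Lemma card_probe d : (#|{: probe d}| <= 3 * (d * d))%N.
Proof.
rewrite /probe !card_sum card_ord.
have : (#|{: {jk : 'I_d * 'I_d | jk.1 != jk.2}}| <= d * d)%N.
  rewrite card_sig -[in (d * d)%N](card_ord d) -card_prod; exact: max_card.
have : (d <= d * d)%N by case: d => // d; rewrite leq_pmulr.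
move: #|_| => /= p; lia.
Qed.

(** The unit-cost operations number at most [9 d^4 + 4 d^3 + 5 d^2 + 6 d + 13], and
    [37 = 9 + 4 + 5 + 6 + 13]. *)
Definition tso_time (w : costs) (d : nat) : nat :=
  37 * expn d 6 + lre_offline_cost w d + 3 * (d * d) * lre_online_cost w d
  + spectral_cost w (d * d) + polar_cost w d + schur_cost w d.

Lemma tso_costs_le w d (d_gt0 : (0 < d)%N) :
   (1 + (1 + (1 + (1 + (1 + (1 + (1 + (lre_offline_cost w d +
     (#|{: probe d}| * lre_online_cost w d +
     (d * d * (d * d) * 6 +
     (cost_S w d + (polar_cost w d + cost_H w d))))))))))) <= tso_time w d)%N.
Proof.
rewrite /cost_S /cost_H /tso_time.
have : (#|{: probe d}| * lre_online_cost w d <=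
        3 * (d * d) * lre_online_cost w d)%N.
  by rewrite leq_mul2r card_probe orbT.
have pow k : (k <= 6)%N -> (expn d k <= expn d 6)%N by exact: leq_pexp2l.
have := pow 0%N isT; have := pow 1%N isT; have := pow 2%N isT.
have := pow 3%N isT; have := pow 4%N isT.
have -> : (d * d * (d * d) = expn d 4)%N by rewrite !mulnn -expnM.
have -> : (d * d * (d * (1 + (1 + 1)) + (d + 1 + 1)) =
           4 * expn d 3 + 2 * expn d 2)%N.
  by rewrite !expnS expn0; lia.
rewrite !mulnn expn0 expn1.
(* With the powers of [d] and the oracle costs abstracted, a linear inequality is left. *)
move: (_ * lre_online_cost w d)%N (_ * lre_online_cost w d)%N => p q.
move: (spectral_cost _ _) (polar_cost _ _) (schur_cost _ _) => x y z.
move: (lre_offline_cost _ _) (expn d 6) (expn d 4) (expn d 3) (expn d 2) => *.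
lia.
Qed.

Lemma tso_time_O (R : realType) w :
  isO R (spectral_cost w) (fun n => expn n 3) ->
  isO R (polar_cost w) (fun n => expn n 3) ->
  isO R (schur_cost w) (fun n => expn n 3) ->
  isO R (lre_offline_cost w) (fun d => expn d 6) ->
  isO R (lre_online_cost w) (fun d => expn d 4) ->
  isO R (tso_time w) (fun d => expn d 6).
Proof.
move=> /isOP[C1 [K1 H1]] /isOP[C2 [K2 H2]] /isOP[C3 [K3 H3]].
move=> /isOP[C4 [K4 H4]] /isOP[C5 [K5 H5]]; apply/isOP.
(* The 3 counts the [3 d^2] reconstructions. The threshold exceeds all the [Ki], and its extra 1
   gives [0 < n], hence [n <= n^2], so the spectral bound applies at [n^2]. *)
exists (37 + C1 + C2 + C3 + C4 + 3 * C5)%N, (1 + K1 + K2 + K3 + K4 + K5)%N => n Kn.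
have n0 : (0 < n)%N by lia.
have nn : (n <= n * n)%N by rewrite leq_pmulr.
have := H1 (n * n)%N ltac:(lia); have := H2 n ltac:(lia).
have := H3 n ltac:(lia); have := H4 n ltac:(lia); have := H5 n ltac:(lia).
rewrite /tso_time => h5 h4 h3 h2 h1.
have n36 : (expn n 3 <= expn n 6)%N by exact: leq_pexp2l.
(* The spectral decomposition in dimension [n^2] costs a multiple of [(n^2)^3 = n^6]. *)
rewrite -[(n * n)%N]/(expn n 2) -expnM in h1 *.
have {}h5 : (3 * expn n 2 * lre_online_cost w n <= 3 * C5 * expn n 6)%N.
  by rewrite (expnD n 2 4) mulnACA leq_mul2l h5 orbT.
have {}h2 := leq_trans h2 (leq_mul (leqnn C2) n36).
have {}h3 := leq_trans h3 (leq_mul (leqnn C3) n36).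
rewrite !mulnDl; lia.
Qed.

Theorem mainTheorem2 (R : realType) (nf ns : nat -> nat) (w : costs)
    (Hspectral : isO R (spectral_cost w) (fun n => expn n 3))
    (Hpolar : isO R (polar_cost w) (fun n => expn n 3))
    (Hschur : isO R (schur_cost w) (fun n => expn n 3))
    (Hoffline : isO R (lre_offline_cost w) (fun d => expn d 6))
    (Honline : isO R (lre_online_cost w) (fun d => expn d 4)) :
  exists (P : forall d : nat, prog nf ns (tso_result d addr)) (T : nat -> nat),
    implements_tso R w P T /\ isO R T (fun d => expn d 6).
Proof.
(* Junk: only [0 < d] is specified. *)
pose none : tso_result 0 addr :=
  TSOResult (const_mx 0%N) (const_mx 0%N) (const_mx 0%N)
            (const_mx 0%N) (const_mx 0%N) (const_mx 0%N).
exists (fun d => match d with 0%N => Ret nf ns none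
                 | d'.+1 => tso_program nf ns d' end), (tso_time w).
split; last exact: tso_time_O Hspectral Hpolar Hschur Hoffline Honline.
move=> [//|d'] O Htrue h1 t freq _ _ _ _.
have := runs_tso_program O w h1 t freq; rewrite /runs.
case: (exec _ _ _ _) => -[r m] c [_ run le]; split=> //.
exact: leq_trans le (tso_costs_le w (ltn0Sn d')).
Qed.
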